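(* Let $D\ge 2$ and $N\ge 1$ be integers, let $p_0,\ldots,p_{N-1}\in\{0,\ldots,D-1\}$, and let $\mathbf q=(q_0,\ldots,q_{N-1})^T\in\mathbb C^N$. Let $M\ge0$ be an integer. Assume that $\mathbf 1_N^T\mathbf q\neq 0$ and that the moment-nulling conditions $$\mu_{r,m}=0,\qquad r=1,\ldots,D-1,\quad m=0,\ldots,M,$$ hold. Then, for every $\theta\in\mathbb R$, $$\frac{\sum_{r=1}^{D-1}|S_r(\theta)|}{|\mathbf 1_N^T\mathbf q|}\ \le\ \frac{D-1}{\sqrt{\eta_{\mathrm{SNR}}}}\sum_{m=M+1}^{\infty}\frac{(N|\theta|)^m}{m!\,\sqrt{2m+1}} .$$
   Context: Let $\omega=e^{j2\pi/D}$, where $j$ is the imaginary unit, and let $\mathbf 1_N$ be the all-ones vector of length $N$, so that $\mathbf 1_N^T\mathbf q=\sum_{n=0}^{N-1}q_n$. For $r=0,\ldots,D-1$: - slow-time mode response: $S_r(\theta)=\sum_{n=0}^{N-1}q_n\,\omega^{rp_n}e^{jn\theta}$; - slow-time moments: $\mu_{r,m}=\sum_{n=0}^{N-1}q_n\,\omega^{rp_n}n^m$ for $m=0,1,2,\ldots$ (with $0^0=1$). The SNR efficiency is $\eta_{\mathrm{SNR}}=\dfrac{|\mathbf 1_N^T\mathbf q|^2}{N\|\mathbf q\|_2^2}$, where $\|\cdot\|_2$ is the Euclidean norm. *)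

(* Defs.v *)
From HB Require Import structures.
From mathcomp Require Import all_boot all_order all_algebra.
From mathcomp Require Import complex.
From mathcomp Require Import all_classical all_reals all_analysis.
Set Implicit Arguments.
Unset Strict Implicit.
Unset Printing Implicit Defensive.
Import Order.TTheory GRing.Theory Num.Theory.
Import numFieldNormedType.Exports.
Local Open Scope classical_set_scope.
Local Open Scope ring_scope.
Local Open Scope complex_scope.

(* The modulus with values in R; the library norm `|z| lives in R[i]. *)
Definition cmod (R : realType) (z : R[i]) : R := ComplexField.Normc.normc z.

(* e^{jx} for real x, by Euler's formula. *)
Definition expi (R : realType) (x : R) : R[i] := cos x +i* sin x.

Definition omega (R : realType) (D : nat) : R[i] := expi (2 * pi / D%:R).

Definition ones_dot (R : realType) (N : nat) (q : 'cV[R[i]]_N) : R[i] :=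
  ((const_mx 1 : 'cV[R[i]]_N)^T *m q) 0 0.

(* The library norm on matrices is the sup norm, not the Euclidean one. *)
Definition l2norm (R : realType) (N : nat) (q : 'cV[R[i]]_N) : R :=
  Num.sqrt (\sum_(n < N) cmod (q n 0) ^+ 2).

Definition mode_response (R : realType) (D N : nat) (p : 'I_N -> 'I_D)
    (q : 'cV[R[i]]_N) (r : nat) (theta : R) : R[i] :=
  \sum_(n < N) q n 0 * omega R D ^+ (r * p n) * expi (n%:R * theta).

(* The library convention x ^+ 0 = 1 gives 0^0 = 1 in the term n = m = 0. *)
Definition moment (R : realType) (D N : nat) (p : 'I_N -> 'I_D)
    (q : 'cV[R[i]]_N) (r m : nat) : R[i] :=
  \sum_(n < N) q n 0 * omega R D ^+ (r * p n) * n%:R ^+ m.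

Definition snr_efficiency (R : realType) (N : nat) (q : 'cV[R[i]]_N) : R :=
  cmod (ones_dot q) ^+ 2 / (N%:R * l2norm q ^+ 2).

(* Main.v *)
Require Import Defs.
From HB Require Import structures.
From mathcomp Require Import all_boot all_order all_algebra.
From mathcomp Require Import complex.
From mathcomp Require Import all_classical all_reals all_analysis.
From mathcomp Require Import ring zify.
Import Order.TTheory GRing.Theory Num.Theory.
Import numFieldNormedType.Exports.
Local Open Scope classical_set_scope.
Local Open Scope ring_scope.
Local Open Scope complex_scope.

(* For [K > M], truncate the Taylor series of [e^{jn theta}] at order [K] in
   [S_r(theta)]: the order-[m] term contributes [(j theta)^m / m! * mu_{r,m}],
   which vanishes for [m <= M].  For [m > M], Cauchy-Schwarz and
   [sum_{n<N} n^{2m} <= N^{2m+1} / (2m+1)] give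
   [|mu_{r,m}| <= ||q|| sqrt N * N^m / sqrt (2m+1)].  Letting [K] grow and
   using [||q|| sqrt N / |1^T q| = 1 / sqrt eta_SNR] yields the bound. *)

(** The sum is empty, hence zero, as long as [K <= M.+1]. *)
Local Notation taylor_tail x M := (fun K : nat =>
  \sum_(M.+1 <= m < K) x ^+ m / (m`!%:R * Num.sqrt (2 * m%:R + 1))).

(** Lagrange's identity: twice the defect is the sum over all pairs of the squares
    [(a i * b j - a j * b i) ^+ 2]. *)
Lemma cauchy_schwarz_sum (R : realDomainType) (I : finType) (a b : I -> R) :
  (\sum_i a i * b i) ^+ 2 <= (\sum_i a i ^+ 2) * (\sum_i b i ^+ 2).
Proof.
have lagrange : \sum_i \sum_j (a i * b j - a j * b i) ^+ 2 =
    ((\sum_i a i ^+ 2) * (\sum_i b i ^+ 2) - (\sum_i a i * b i) ^+ 2) *+ 2.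
  transitivity (\sum_i \sum_j (a i ^+ 2 * b j ^+ 2 + b i ^+ 2 * a j ^+ 2
      - (a i * b i * (a j * b j)) *+ 2)).
    by apply: eq_bigr => i _; apply: eq_bigr => j _; ring.
  rewrite (eq_bigr (fun i => a i ^+ 2 * (\sum_j b j ^+ 2)
      + b i ^+ 2 * (\sum_j a j ^+ 2)
      - (a i * b i * (\sum_j a j * b j)) *+ 2)); last first.
    by move=> i _; rewrite !big_split /= sumrN sumrMnl -!big_distrr.
  by rewrite !big_split /= sumrN sumrMnl -!big_distrl /=; ring.
have : 0 <= \sum_i \sum_j (a i * b j - a j * b i) ^+ 2.
  by apply: sumr_ge0 => i _; apply: sumr_ge0 => j _; exact: sqr_ge0.
by rewrite lagrange pmulrn_lge0 // subr_ge0.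
Qed.

(** Discrete form of the integral of [x^k] over [[0, N]], by induction on [N]. *)
Lemma sum_powers_le (k N : nat) :
  (k.+1 * \sum_(n < N) n ^ k <= N ^ k.+1)%N.
Proof.
elim: N => [|N IH]; first by rewrite big_ord0 muln0.
rewrite big_ord_recr /= mulnDr.
(* The first two terms of the binomial expansion; multiplying the case [l] by [N + 1] and dropping a
   nonnegative term gives the next case. *)
have bernoulli : (N ^ k.+1 + k.+1 * N ^ k <= N.+1 ^ k.+1)%N.
  elim: (k) => [|l IHl]; first by rewrite !expn1 expn0 muln1 addn1.
  rewrite [X in (_ <= X)%N]expnS; apply: leq_trans (leq_mul (leqnn _) IHl).
  rewrite !expnS; lia.
by apply: leq_trans bernoulli; rewrite leq_add2r.
Qed.

Lemma cmod_sum (R : realType) (I : finType) (F : I -> R[i]) :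
  cmod (\sum_i F i) <= \sum_i cmod (F i).
Proof.
elim/big_rec2: _ => [|i y x _ IH].
  by rewrite /cmod ComplexField.Normc.normc0.
by apply: le_trans (lerD (lexx _) IH); exact: le_normcD.
Qed.

Lemma cmodM (R : realType) (x y : R[i]) : cmod (x * y) = cmod x * cmod y.
Proof. exact: ComplexField.Normc.normcM. Qed.

Lemma cmod_ge0 (R : realType) (x : R[i]) : 0 <= cmod x.
Proof. by case: x => a b; exact: sqrtr_ge0. Qed.

Lemma cmod_real (R : realType) (x : R) : cmod x%:C = `|x|.
Proof. by rewrite /cmod /= expr0n addr0 sqrtr_sqr. Qed.

Lemma cmod_leD (R : realType) (a b : R) : cmod (a +i* b) <= `|a| + `|b|.
Proof.
have -> : a +i* b = a%:C + (0 +i* b) by simpc.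
apply: le_trans (le_normcD _ _) _.
by rewrite /= !expr0n addr0 add0r !sqrtr_sqr.
Qed.

Lemma cmod_expi (R : realType) (x : R) : cmod (expi x) = 1.
Proof. by rewrite /cmod /= cos2Dsin2 sqrtr1. Qed.

Lemma cmodX (R : realType) (x : R[i]) n : cmod (x ^+ n) = cmod x ^+ n.
Proof. by elim: n => [|n IH]; rewrite ?expr0 ?exprS ?cmodM ?IH // /cmod ComplexField.Normc.normc1. Qed.

(** Even powers of ['i] are real and odd ones imaginary. The cosine and sine coefficients are zero
    at indices of the wrong parity, so all three series share the index [m]. *)
Lemma exp_term_trigo_coeff (R : realType) (y : R) (m : nat) :
  ('i * y%:C) ^+ m / m`!%:R = cos_coeff y m +i* sin_coeff y m.
Proof.
have -> : (m`!%:R : R[i])^-1 = (m`!%:R^-1)%:C by rewrite fmorphV rmorph_nat.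
have i_pow : ('i ^+ m : R[i]) = ((~~ odd m)%:R * (-1) ^+ m./2) +i*
    ((odd m)%:R * (-1) ^+ m.-1./2).
  have i_even k : ('i ^+ k.*2 : R[i]) = ((-1) ^+ k)%:C.
    by rewrite -mul2n exprM sqr_i rmorphXn rmorphN1.
  rewrite -(odd_double_half m); case: (odd m).
    by rewrite add1n /= odd_double doubleK exprS i_even; simpc.
  by rewrite add0n odd_double doubleK i_even; simpc.
rewrite exprMn i_pow -rmorphXn /cos_coeff /sin_coeff /= exprnP; simpc.
by [].
Qed.

(** Real and imaginary parts of the partial sums are those of the cosine and sine series, so the
    error is squeezed below the sum of two real remainders. *)
Lemma cmod_expi_taylor_cvg (R : realType) (y : R) :
  (fun K => cmod (expi y - \sum_(m < K) ('i * y%:C) ^+ m / m`!%:R)) @ \oo --> (0 : R).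
Proof.
have partial K : \sum_(m < K) ('i * y%:C) ^+ m / m`!%:R =
    series (cos_coeff y) K +i* series (sin_coeff y) K.
  rewrite /series /= !big_mkord; elim: K => [|K IH]; first by rewrite !big_ord0.
  by rewrite !big_ord_recr /= IH exp_term_trigo_coeff; simpc.
apply: (@squeeze_cvgr _ _ _ _ (fun=> 0)
  (fun K => `|cos y - series (cos_coeff y) K| + `|sin y - series (sin_coeff y) K|)).
- apply: nearW => K; rewrite cmod_ge0 partial /expi; simpc.
  exact: cmod_leD.
- exact: cvg_cst.
have -> : 0 = `|cos y - cos y| + `|sin y - sin y| :> R by rewrite !subrr normr0 addr0.
apply: cvgD; apply: cvg_norm; apply: cvgB; try exact: cvg_cst.
  (* Once unlocked, the cosine is the limit of its series, so summability is exactly the claim;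
     likewise for the sine. *)
  by rewrite cos.unlock; exact: is_cvg_series_cos_coeff.
by rewrite sin.unlock; exact: is_cvg_series_sin_coeff.
Qed.

Lemma tail_term_ge0 (R : realType) (x : R) m : 0 <= x ->
  0 <= x ^+ m / (m`!%:R * Num.sqrt (2 * m%:R + 1)).
Proof.
by move=> x0; rewrite divr_ge0 ?exprn_ge0 // mulr_ge0 ?ler0n ?sqrtr_ge0.
Qed.

(** The partial sums increase and, because [sqrt (2m + 1) >= 1], stay below the exponential series.
    Hence they converge, and [limn] is a genuine limit that bounds them. *)
Lemma taylor_tail_le_limn (R : realType) (x : R) (M K : nat) : 0 <= x ->
  taylor_tail x M K <= limn (taylor_tail x M).
Proof.
move=> x0.
have incr : nondecreasing_seq (taylor_tail x M).
  move=> a b ab /=; case: (leqP M.+1 a) => Ma; last first.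
    by rewrite big_geq 1?ltnW // sumr_ge0 // => m _; exact: tail_term_ge0.
  rewrite [leRHS](big_cat_nat Ma ab) /= lerDl.
  by rewrite sumr_ge0 // => m _; exact: tail_term_ge0.
apply: nondecreasing_cvgn_le => //; apply: nondecreasing_is_cvgn => //.
exists (limn (series (exp_coeff x))) => _ [k _ <-].
apply: (@le_trans _ _ (series (exp_coeff x) k)); last first.
  apply: nondecreasing_cvgn_le (is_cvg_series_exp_coeff x) k.
  move=> a b ab; rewrite /series /= [leRHS](big_cat_nat (leq0n a) ab) /= lerDl.
  by rewrite sumr_ge0 // => m _; exact: exp_coeff_ge0.
rewrite /series /=; case: (leqP M.+1 k) => Mk; last first.
  by rewrite big_geq 1?ltnW // sumr_ge0 // => m _; exact: exp_coeff_ge0.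
rewrite [leRHS](big_cat_nat (leq0n M.+1) Mk) /=.
rewrite -[leLHS]add0r lerD //.
  by rewrite sumr_ge0 // => m _; exact: exp_coeff_ge0.
apply: ler_sum => m _; rewrite /exp_coeff /= ler_wpM2l ?exprn_ge0 //.
have f0 : 0 < m`!%:R :> R by rewrite ltr0n fact_gt0.
have s1 : 1 <= Num.sqrt (2 * m%:R + 1) :> R.
  by rewrite -{1}sqrtr1 ler_wsqrtr // lerDr mulr_ge0.
rewrite lef_pV2 ?posrE ?ler_peMr ?(ltW f0) ?mulr_gt0 ?(lt_le_trans ltr01 s1) //.
Qed.

(** The weights [c] are arbitrary so that the phases of a mode can be absorbed into them. *)
Lemma cmod_moment_le (R : realType) (N m : nat) (c : 'I_N -> R[i]) :
  cmod (\sum_(n < N) c n * n%:R ^+ m) <=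
  Num.sqrt N%:R * Num.sqrt (\sum_(n < N) cmod (c n) ^+ 2) *
    (N%:R ^+ m / Num.sqrt (2 * m%:R + 1)).
Proof.
set S := \sum_(n < N) cmod (c n) ^+ 2.
have S0 : 0 <= S by apply: sumr_ge0 => n _; exact: sqr_ge0.
have d0 : 0 < 2 * m%:R + 1 :> R by rewrite ltr_wpDl ?mulr_ge0.
apply: le_trans (cmod_sum _ _ _) _.
have -> : \sum_(n < N) cmod (c n * n%:R ^+ m) = \sum_(n < N) cmod (c n) * n%:R ^+ m.
  apply: eq_bigr => n _; rewrite cmodM cmodX; congr (_ * _ ^+ _).
  by rewrite -(rmorph_nat (real_complex R)) cmod_real ger0_norm.
rewrite -(@ler_pXn2r _ 2) ?nnegrE //; last first.
  by apply: sumr_ge0 => n _; rewrite mulr_ge0 ?cmod_ge0 ?exprn_ge0.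
apply: le_trans (cauchy_schwarz_sum _ _ _ _) _.
rewrite -/S !exprMn !exprVn !sqr_sqrtr ?ler0n ?(ltW d0) //.
rewrite [X in _ <= X * _]mulrC -mulrA ler_wpM2l //.
(* With both sides squared and [S] cancelled, there remains the power-sum bound with exponent [2m],
   where [N * (N^m)^2 = N^(2m+1)]. *)
rewrite mulrA ler_pdivlMr // -exprM -exprS.
have := sum_powers_le (2 * m) N.
rewrite -(ler_nat R) natrM natrX natr_sum -natr1 natrM mulrC.
rewrite (_ : (m * 2).+1 = (2 * m).+1); last by rewrite mulnC.
apply: le_trans; rewrite ler_wpM2r ?(ltW d0) //.
by apply: ler_sum => n _; rewrite natrX -exprM mulnC.
Qed.

Lemma cmod_fourier_sum_le (R : realType) (N M : nat) (c : 'I_N -> R[i]) (theta : R) :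
  (forall m, (m <= M)%N -> \sum_(n < N) c n * n%:R ^+ m = 0) ->
  cmod (\sum_(n < N) c n * expi (n%:R * theta)) <=
  Num.sqrt N%:R * Num.sqrt (\sum_(n < N) cmod (c n) ^+ 2) *
    limn (taylor_tail (N%:R * `|theta|) M).
Proof.
move=> mu0.
set A := Num.sqrt N%:R * _.
have A0 : 0 <= A by rewrite mulr_ge0 ?sqrtr_ge0.
have x0 : 0 <= N%:R * `|theta| by rewrite mulr_ge0.
pose y (n : 'I_N) : R := n%:R * theta.
pose T K (n : 'I_N) := \sum_(m < K) ('i * (y n)%:C) ^+ m / m`!%:R.
have tail K : (M < K)%N ->
    cmod (\sum_(n < N) c n * T K n) <= A * limn (taylor_tail (N%:R * `|theta|) M).
  move=> MK.
  (* Exchanging the finite sums makes the moments of [c] appear, so that orders up to [M] drop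
     out. *)
  have -> : \sum_(n < N) c n * T K n = \sum_(0 <= m < K)
      (('i * theta%:C) ^+ m / m`!%:R) * \sum_(n < N) c n * n%:R ^+ m.
    rewrite big_mkord; under [RHS]eq_bigr do rewrite big_distrr /=.
    rewrite exchange_big /=; apply: eq_bigr => n _; rewrite big_distrr /=.
    apply: eq_bigr => m _; rewrite /y rmorphM rmorph_nat !exprMn; ring.
  rewrite (big_cat_nat (leq0n M.+1) MK) /= big1_seq ?add0r; last first.
    by move=> m; rewrite mem_index_iota => /andP[_ mM]; rewrite mu0 ?mulr0.
  apply: (@le_trans _ _ (A * taylor_tail (N%:R * `|theta|) M K)); last first.
    by rewrite ler_wpM2l // taylor_tail_le_limn.
  rewrite big_distrr /=.
  elim/big_rec2: _ => [|m z w _ IH].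
    by rewrite /cmod ComplexField.Normc.normc0.
  apply: le_trans (le_normcD _ _) _; apply: lerD IH.
  rewrite -/(cmod _) cmodM.
  have -> : cmod (('i * theta%:C) ^+ m / m`!%:R) = `|theta| ^+ m / m`!%:R.
    have -> : (m`!%:R : R[i])^-1 = (m`!%:R^-1)%:C by rewrite fmorphV rmorph_nat.
    rewrite cmodM cmodX cmodM !cmod_real [cmod 'i]/cmod /=.
    by rewrite expr0n expr1n add0r sqrtr1 mul1r [`|_^-1|]ger0_norm ?invr_ge0.
  apply: le_trans (ler_wpM2l _ (cmod_moment_le _ _ m c)) _.
    by rewrite mulr_ge0 ?invr_ge0 ?exprn_ge0.
  by rewrite -/A exprMn invfM le_eqVlt; apply/orP; left; apply/eqP; ring.
(* A finite combination of truncation errors: pointwise convergence of each exponential makes it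
   vanish in the limit. *)
pose err K := \sum_(n < N) cmod (c n) * cmod (expi (y n) - T K n).
have err0 : err @ \oo --> 0.
  have -> : 0 = \sum_(n < N) cmod (c n) * 0 by rewrite big1 // => n _; rewrite mulr0.
  apply: cvg_big; first exact: add_continuous.
  by move=> n _; apply: cvgMr; exact: cmod_expi_taylor_cvg.
apply: (@ler_cvg_to _ \oo _ _ (fun=> cmod (\sum_(n < N) c n * expi (y n)))
  (fun K => A * limn (taylor_tail (N%:R * `|theta|) M) + err K)).
- exact: cvg_cst.
- rewrite -[X in _ --> X]addr0; apply: cvgD err0; exact: cvg_cst.
(* The comparison is only asked for eventually, and [tail] applies from [K = M + 1] on, with a bound
   independent of [K]. *)
exists M.+1 => // K /= MK.
have -> : \sum_(n < N) c n * expi (y n) =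
    \sum_(n < N) c n * T K n + \sum_(n < N) c n * (expi (y n) - T K n).
  by rewrite -big_split /=; apply: eq_bigr => n _; ring.
apply: le_trans (le_normcD _ _) _; apply: lerD; first exact: tail.
apply: le_trans (cmod_sum _ _ _) _; rewrite /err.
by under eq_bigr do rewrite cmodM.
Qed.

Theorem mainTheorem2 (R : realType) (D N : nat) (hD : (2 <= D)%N)
    (hN : (1 <= N)%N) (p : 'I_N -> 'I_D) (q : 'cV[R[i]]_N) (M : nat)
    (hq : ones_dot q <> 0)
    (hmu : forall r m : nat, (1 <= r < D)%N -> (m <= M)%N ->
      moment p q r m = 0)
    (theta : R) :
  (\sum_(1 <= r < D) cmod (mode_response p q r theta)) / cmod (ones_dot q) <=
  (D%:R - 1) / Num.sqrt (snr_efficiency q) *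
    limn (fun K : nat => \sum_(M.+1 <= m < K)
      (N%:R * `|theta|) ^+ m / (m`!%:R * Num.sqrt (2 * m%:R + 1))).
Proof.
have l0 : 0 <= l2norm q by exact: sqrtr_ge0.
set L := limn _.
have mode r : (1 <= r < D)%N ->
    cmod (mode_response p q r theta) <= Num.sqrt N%:R * l2norm q * L.
  (* The factors [omega ^+ (r * p n)] have modulus 1, so the weights have the same Euclidean norm as
     [q]. *)
  move=> hr; have := @cmod_fourier_sum_le R N M
    (fun n => q n 0 * omega R D ^+ (r * p n)) theta (fun m => hmu r m hr).
  rewrite (eq_bigr (fun n => cmod (q n 0) ^+ 2)) // => n _.
  by rewrite cmodM cmodX cmod_expi expr1n mulr1.
have -> : (D%:R - 1) / Num.sqrt (snr_efficiency q) =
    (D%:R - 1) * (Num.sqrt N%:R * l2norm q) / cmod (ones_dot q).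
  rewrite /snr_efficiency sqrtrM ?sqr_ge0 // sqrtrV ?mulr_ge0 ?sqr_ge0 //.
  rewrite sqrtr_sqr sqrtrM ?ler0n // sqrtr_sqr (ger0_norm (cmod_ge0 _ _)).
  by rewrite (ger0_norm l0) invfM invrK mulrA mulrAC.
rewrite mulrAC ler_wpM2r ?invr_ge0 ?cmod_ge0 //.
(* [D - 1] counts the modes [1 <= r < D], each of which obeys the same bound. *)
rewrite -(natrB R (ltnW hD)) -mulrA mulr_natl.
rewrite -sumr_const_nat [leLHS]big_nat_cond [leRHS]big_nat_cond.
by apply: ler_sum => r /andP[hr _]; exact: mode.
Qed.
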